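(* Let $(\mathfrak{g},[-,-],\omega)$ be a finite-dimensional nontrivial $\omega$-Lie algebra over $\mathbb{C}$. Then the set $\mathrm{Aut}_{\omega}(\mathfrak{g})$ of all $\omega$-automorphisms of $\mathfrak{g}$ is a subgroup of the automorphism group $\mathrm{Aut}(\mathfrak{g})$.
   Context: An $\omega$-Lie algebra over $\mathbb{C}$ is a triple $(\mathfrak{g},[-,-],\omega)$ where $\mathfrak{g}$ is a finite-dimensional complex vector space, $[-,-]:\mathfrak{g}\times\mathfrak{g}\to\mathfrak{g}$ is a skew-symmetric bilinear bracket and $\omega:\mathfrak{g}\times\mathfrak{g}\to\mathbb{C}$ is a bilinear form (necessarily skew-symmetric in the nontrivial case) such that $$[[x,y],z]+[[y,z],x]+[[z,x],y]=\omega(x,y)z+\omega(y,z)x+\omega(z,x)y$$ for all $x,y,z\in\mathfrak{g}$. It is called nontrivial if $(\mathfrak{g},[-,-])$ is not a Lie algebra. An automorphism of $\mathfrak{g}$ is a linear isomorphism $\rho:\mathfrak{g}\to\mathfrak{g}$ with $\rho([x,y])=[\rho(x),\rho(y)]$ for all $x,y\in\mathfrak{g}$; $\mathrm{Aut}(\mathfrak{g})$ is the group of all automorphisms under composition. An automorphism $\rho$ is an $\omega$-automorphism if $\omega(x,y)=\omega(\rho(x),\rho(y))$ for all $x,y\in\mathfrak{g}$. *)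

(* Defs.v *)
From HB Require Import structures.
From mathcomp Require Import all_boot all_algebra.
From mathcomp Require Import boolp reals complex.

Set Implicit Arguments.
Unset Strict Implicit.
Unset Printing Implicit Defensive.

Import GRing.Theory.
Local Open Scope ring_scope.

(* The complex numbers are R[i] for an arbitrary R : realType. *)
Section OmegaLie.
Variables (R : realType) (g : vectType R[i]).
Implicit Types (br : {bilinear g -> g -> g}) (om : {biscalar g}).

Definition skew_symmetric_bracket br := forall x y : g, br x y = - br y x.

Definition is_lie br :=
  skew_symmetric_bracket br /\
  forall x y z : g, br (br x y) z + br (br y z) x + br (br z x) y = 0.

(* om is not required to be skew-symmetric: this is a consequence of the
   identity below when the algebra is nontrivial. *)
Definition is_omega_lie br om :=
  skew_symmetric_bracket br /\
  forall x y z : g,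
    br (br x y) z + br (br y z) x + br (br z x) y =
    om x y *: z + om y z *: x + om z x *: y.

Definition nontrivial br := ~ is_lie br.

Definition is_automorphism br (f : 'End(g)) :=
  bijective f /\ forall x y : g, f (br x y) = br (f x) (f y).

Record Aut br := MkAut {
  aut_lfun :> 'End(g);
  _ : `[< is_automorphism br aut_lfun >]
}.

HB.instance Definition _ br := [isSub for @aut_lfun br].
HB.instance Definition _ br := [Choice of Aut br by <:].

Section AutGroup.
Variable br : {bilinear g -> g -> g}.
Implicit Types r s t : Aut br.

Lemma autP r : is_automorphism br r.
Proof. by case: r => f /= /asboolP. Qed.

Fact id_is_aut : is_automorphism br \1%VF.
Proof.
split; last by move=> x y; rewrite !id_lfunE.
by exists id => x; rewrite ?id_lfunE.
Qed.

Fact comp_is_aut r s : is_automorphism br (r \o s)%VF.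
Proof.
have [[r' rK r'K] rM] := autP r; have [[s' sK s'K] sM] := autP s.
split; last by move=> x y; rewrite !comp_lfunE sM rM.
by exists (s' \o r') => x; rewrite comp_lfunE /= ?rK ?sK // s'K r'K.
Qed.

Lemma aut_lker0 r : lker r == 0%VS.
Proof. by have [/bij_inj/lker0P] := autP r. Qed.

Fact inv_is_aut r : is_automorphism br (r^-1)%VF.
Proof.
have rK := lker0_lfunK (aut_lker0 r); have r'K := lker0_lfunVK (aut_lker0 r).
split; first by exists r.
by move=> x y; rewrite -{1}[x]r'K -{1}[y]r'K -(autP r).2 rK.
Qed.

Definition aut_one : Aut br := MkAut (asboolT id_is_aut).
Definition aut_mul r s : Aut br := MkAut (asboolT (comp_is_aut r s)).
Definition aut_inv r : Aut br := MkAut (asboolT (inv_is_aut r)).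

Fact aut_mulA : associative aut_mul.
Proof. by move=> r s t; apply/val_inj/comp_lfunA. Qed.
Fact aut_mul1g : left_id aut_one aut_mul.
Proof. by move=> r; apply/val_inj/comp_lfun1l. Qed.
Fact aut_mulg1 : right_id aut_one aut_mul.
Proof. by move=> r; apply/val_inj/comp_lfun1r. Qed.
Fact aut_mulVg : left_inverse aut_one aut_inv aut_mul.
Proof. by move=> r; apply/val_inj/lker0_compVf/aut_lker0. Qed.
Fact aut_mulgV : right_inverse aut_one aut_inv aut_mul.
Proof. by move=> r; apply/val_inj/lker0_compfV/aut_lker0. Qed.

HB.instance Definition _ := isGroup.Build (Aut br)
  aut_mulA aut_mul1g aut_mulg1 aut_mulVg aut_mulgV.

Definition Aut_omega om : {pred Aut br} :=
  [pred r : Aut br | `[< forall x y : g, om x y = om (r x) (r y) >]].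

End AutGroup.
End OmegaLie.

Arguments Aut_omega {R g} br om.

(* Main.v *)
Require Import Defs.
From mathcomp Require Import all_boot all_algebra.
From mathcomp Require Import boolp reals complex.
Local Open Scope ring_scope.

Theorem proposition2p3 (R : realType) (g : vectType R[i])
    (br : {bilinear g -> g -> g}) (om : {biscalar g})
    (omega_lie_g : is_omega_lie br om) (nontrivial_g : nontrivial br) :
  group_closed (Aut_omega br om).
Proof.
split=> [|r s /asboolP omr /asboolP oms].
  by apply/asboolP => x y /=; rewrite !id_lfunE.
(* Both sides equal om (s^-1 x) (s^-1 y): r preserves om on these preimages,
   and s, which maps them back to x and y, does too. *)
apply/asboolP => x y /=; rewrite !comp_lfunE -omr.
by rewrite [RHS]oms !(lker0_lfunVK (aut_lker0 s)).
Qed.
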